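(* Assume $\mathsf{CT_Q}$. Let $\mathcal{M}$ be a model of $\mathsf{HA}$ such that the predicate $\mathsf{std}$ on $\mathcal{M}$ is stable. If $\mathcal{M}>\mathbb{N}$, then $\neg\neg\,\exists d:\mathcal{M}.\ \neg\mathsf{Dec}(\lambda n:\mathbb{N}.\ \mathcal{M}\vDash \overline{n}\mid d)$.
   Context: Meta-theory: constructive type theory (Calculus of Inductive Constructions); propositions live in an impredicative universe $\mathbb{P}$, $\exists,\lor$ are propositional; no classical axioms assumed. A predicate $p$ is stable if $\neg\neg p\,x\to p\,x$ for all $x$. For $p:X\to\mathbb{P}$, $\mathsf{Dec}(p)$ means $\exists f:X\to\mathbb{B}.\ \forall x.\ p\,x\leftrightarrow f\,x=\mathsf{tt}$. Arithmetic signature $0,S,+,\times,=$. $\mathsf{HA}$: axioms $\forall x.\, Sx=0\to\bot$; $\forall xy.\, Sx=Sy\to x=y$; $0+x=x$; $(Sx)+y=S(x+y)$; $0\times x=0$; $(Sx)\times y=y+x\times y$; equality axioms (reflexivity, symmetry, transitivity, congruence for $S,+,\times$); induction scheme for every formula; $\vdash$ is intuitionistic natural deduction. $\mathsf{Q}$: same but induction replaced by $\forall x.\, x=0\lor\exists y.\, x=Sy$. A model $\mathcal{M}$ of $\mathsf{HA}$ is a type with interpretations of $0,S,+,\times$, $=$ interpreted as actual equality, satisfying all $\mathsf{HA}$ axioms under Tarski semantics (connectives/quantifiers interpreted type-theoretically). $\overline{n}$ denotes the numeral $S^n0$ and its value in $\mathcal{M}$. $x\mid y:=\exists k.\, x\times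 k=y$. An element $e:\mathcal{M}$ is standard, $\mathsf{std}(e)$, if $\exists n:\mathbb{N}.\ \overline{n}=e$. $\mathcal{M}>\mathbb{N}$ means $\exists e:\mathcal{M}.\neg\mathsf{std}(e)$. A formula is $\Delta_1$ if for every substitution $\sigma$ of closed terms $\mathsf{Q}\vdash\varphi[\sigma]$ or $\mathsf{Q}\vdash\neg\varphi[\sigma]$; $\Sigma_1$ if of the form $\exists x_1\dots\exists x_n.\varphi_0$ with $\varphi_0$ $\Delta_1$. $\mathsf{CT_Q}$: for every $f:\mathbb{N}\to\mathbb{N}$ there is a binary $\Sigma_1$-formula $\varphi_f(x,y)$ with $\mathsf{Q}\vdash\forall y.\,\varphi_f(\overline{n},y)\leftrightarrow\overline{f\,n}=y$ for every $n$. *)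

(* Defs.v *)
From Stdlib Require Import List.
Import ListNotations.

(* First-order arithmetic over 0, S, +, *, = with de Bruijn indices:
   [All] and [Ex] bind [Var 0]. *)

Inductive term : Type :=
| Var : nat -> term
| Zero : term
| Succ : term -> term
| Add : term -> term -> term
| Mul : term -> term -> term.

Inductive form : Type :=
| Fal : form
| Eq : term -> term -> form
| And : form -> form -> form
| Or : form -> form -> form
| Imp : form -> form -> form
| All : form -> form
| Ex : form -> form.

Definition Neg (phi : form) : form := Imp phi Fal.
Definition Iff (phi psi : form) : form := And (Imp phi psi) (Imp psi phi).

Fixpoint numeral (n : nat) : term :=
  match n with
  | 0 => Zero
  | S n => Succ (numeral n)
  end.

Definition scons {X : Type} (x : X) (xi : nat -> X) (n : nat) : X :=
  match n with
  | 0 => x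
  | S n => xi n
  end.

Fixpoint subst_term (sigma : nat -> term) (t : term) : term :=
  match t with
  | Var n => sigma n
  | Zero => Zero
  | Succ t => Succ (subst_term sigma t)
  | Add s t => Add (subst_term sigma s) (subst_term sigma t)
  | Mul s t => Mul (subst_term sigma s) (subst_term sigma t)
  end.

Definition shift_subst (n : nat) : term := Var (S n).

Definition shift_term : term -> term := subst_term shift_subst.

Definition up (sigma : nat -> term) : nat -> term :=
  scons (Var 0) (fun n => shift_term (sigma n)).

Fixpoint subst (sigma : nat -> term) (phi : form) : form :=
  match phi with
  | Fal => Fal
  | Eq s t => Eq (subst_term sigma s) (subst_term sigma t)
  | And phi psi => And (subst sigma phi) (subst sigma psi)
  | Or phi psi => Or (subst sigma phi) (subst sigma psi)
  | Imp phi psi => Imp (subst sigma phi) (subst sigma psi)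
  | All phi => All (subst (up sigma) phi)
  | Ex phi => Ex (subst (up sigma) phi)
  end.

Definition shift : form -> form := subst shift_subst.

(* Replaces [Var 0] by [t] and lowers every other free variable by one. *)
Definition inst (t : term) : form -> form := subst (scons t Var).

(* [bounded_term k t], [bounded k phi]: all free variables are below [k]. *)
Fixpoint bounded_term (k : nat) (t : term) : Prop :=
  match t with
  | Var n => n < k
  | Zero => True
  | Succ t => bounded_term k t
  | Add s t | Mul s t => bounded_term k s /\ bounded_term k t
  end.

Fixpoint bounded (k : nat) (phi : form) : Prop :=
  match phi with
  | Fal => True
  | Eq s t => bounded_term k s /\ bounded_term k t
  | And phi psi | Or phi psi | Imp phi psi => bounded k phi /\ bounded k psi
  | All phi | Ex phi => bounded (S k) phi
  end.

Definition closed_term (t : term) : Prop := bounded_term 0 t.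

(* Intuitionistic natural deduction. *)
Inductive prv : list form -> form -> Prop :=
| Ctx Gamma phi : In phi Gamma -> prv Gamma phi
| Exp Gamma phi : prv Gamma Fal -> prv Gamma phi
| ImpI Gamma phi psi : prv (phi :: Gamma) psi -> prv Gamma (Imp phi psi)
| ImpE Gamma phi psi : prv Gamma (Imp phi psi) -> prv Gamma phi -> prv Gamma psi
| AndI Gamma phi psi : prv Gamma phi -> prv Gamma psi -> prv Gamma (And phi psi)
| AndE1 Gamma phi psi : prv Gamma (And phi psi) -> prv Gamma phi
| AndE2 Gamma phi psi : prv Gamma (And phi psi) -> prv Gamma psi
| OrI1 Gamma phi psi : prv Gamma phi -> prv Gamma (Or phi psi)
| OrI2 Gamma phi psi : prv Gamma psi -> prv Gamma (Or phi psi)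
| OrE Gamma phi psi theta :
    prv Gamma (Or phi psi) -> prv (phi :: Gamma) theta ->
    prv (psi :: Gamma) theta -> prv Gamma theta
| AllI Gamma phi : prv (map shift Gamma) phi -> prv Gamma (All phi)
| AllE Gamma phi t : prv Gamma (All phi) -> prv Gamma (inst t phi)
| ExI Gamma phi t : prv Gamma (inst t phi) -> prv Gamma (Ex phi)
| ExE Gamma phi psi :
    prv Gamma (Ex phi) -> prv (phi :: map shift Gamma) (shift psi) ->
    prv Gamma psi.

Definition eq_axioms : list form :=
  [ All (Eq (Var 0) (Var 0));
    All (All (Imp (Eq (Var 1) (Var 0)) (Eq (Var 0) (Var 1))));
    All (All (All (Imp (Eq (Var 2) (Var 1))
      (Imp (Eq (Var 1) (Var 0)) (Eq (Var 2) (Var 0))))));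
    All (All (Imp (Eq (Var 1) (Var 0)) (Eq (Succ (Var 1)) (Succ (Var 0)))));
    All (All (All (All (Imp (Eq (Var 3) (Var 2)) (Imp (Eq (Var 1) (Var 0))
      (Eq (Add (Var 3) (Var 1)) (Add (Var 2) (Var 0))))))));
    All (All (All (All (Imp (Eq (Var 3) (Var 2)) (Imp (Eq (Var 1) (Var 0))
      (Eq (Mul (Var 3) (Var 1)) (Mul (Var 2) (Var 0)))))))) ].

Definition arith_axioms : list form :=
  [ All (Imp (Eq (Succ (Var 0)) Zero) Fal);
    All (All (Imp (Eq (Succ (Var 1)) (Succ (Var 0))) (Eq (Var 1) (Var 0))));
    All (Eq (Add Zero (Var 0)) (Var 0));
    All (All (Eq (Add (Succ (Var 1)) (Var 0)) (Succ (Add (Var 1) (Var 0)))));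
    All (Eq (Mul Zero (Var 0)) Zero);
    All (All (Eq (Mul (Succ (Var 1)) (Var 0))
      (Add (Var 0) (Mul (Var 1) (Var 0))))) ].

Definition ax_cases : form :=
  All (Or (Eq (Var 0) Zero) (Ex (Eq (Var 1) (Succ (Var 0))))).

(* Induction on [Var 0]; the other free variables of [phi] are parameters. *)
Definition ax_induction (phi : form) : form :=
  Imp (inst Zero phi)
    (Imp (All (Imp phi (subst (scons (Succ (Var 0)) shift_subst) phi)))
      (All phi)).

Definition Q : list form := eq_axioms ++ arith_axioms ++ [ax_cases].

Definition HA (phi : form) : Prop :=
  In phi (eq_axioms ++ arith_axioms) \/ exists psi, phi = ax_induction psi.

Definition Delta1 (phi : form) : Prop :=
  forall sigma : nat -> term, (forall n, closed_term (sigma n)) ->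
    prv Q (subst sigma phi) \/ prv Q (Neg (subst sigma phi)).

Definition Sigma1 (phi : form) : Prop :=
  exists (n : nat) (phi0 : form), Delta1 phi0 /\ phi = Nat.iter n Ex phi0.

(* A binary formula phi(x,y) has x as [Var 0] and y as [Var 1].  Instantiating
   [Var 0] lowers y to [Var 0], which the outer [All] then binds. *)
Definition CT_Q : Prop :=
  forall f : nat -> nat, exists phi : form,
    bounded 2 phi /\ Sigma1 phi /\
    forall n : nat,
      prv Q (All (Iff (inst (numeral n) phi) (Eq (numeral (f n)) (Var 0)))).

Record interp : Type := {
  dom :> Type;
  i_zero : dom;
  i_succ : dom -> dom;
  i_add : dom -> dom -> dom;
  i_mul : dom -> dom -> dom
}.

Fixpoint eval (M : interp) (rho : nat -> M) (t : term) : M :=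
  match t with
  | Var n => rho n
  | Zero => i_zero M
  | Succ t => i_succ M (eval M rho t)
  | Add s t => i_add M (eval M rho s) (eval M rho t)
  | Mul s t => i_mul M (eval M rho s) (eval M rho t)
  end.

Fixpoint sat (M : interp) (rho : nat -> M) (phi : form) : Prop :=
  match phi with
  | Fal => False
  | Eq s t => eval M rho s = eval M rho t
  | And phi psi => sat M rho phi /\ sat M rho psi
  | Or phi psi => sat M rho phi \/ sat M rho psi
  | Imp phi psi => sat M rho phi -> sat M rho psi
  | All phi => forall x : M, sat M (scons x rho) phi
  | Ex phi => exists x : M, sat M (scons x rho) phi
  end.

Definition HA_model (M : interp) : Prop :=
  forall phi, HA phi -> forall rho : nat -> M, sat M rho phi.

Fixpoint i_num (M : interp) (n : nat) : M :=
  match n with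
  | 0 => i_zero M
  | S n => i_succ M (i_num M n)
  end.

Definition std (M : interp) (e : M) : Prop := exists n : nat, i_num M n = e.

Definition nonstandard (M : interp) : Prop := exists e : M, ~ std M e.

Definition stable {X : Type} (p : X -> Prop) : Prop :=
  forall x, ~ ~ p x -> p x.

Definition Dec {X : Type} (p : X -> Prop) : Prop :=
  exists f : X -> bool, forall x, p x <-> f x = true.

Definition Divides (s t : term) : form :=
  Ex (Eq (Mul (shift_term s) (Var 0)) (shift_term t)).

(* [Var 0] is the only free variable of the formula, so the values of the
   assignment at the other variables do not matter. *)
Definition num_divides (M : interp) (n : nat) (d : M) : Prop :=
  sat M (fun _ => d) (Divides (numeral n) (Var 0)).

(* Main.v *)
(** By [CT_Q], the computable sets A and B of codes n of formulas for which [Q]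
    proves that the n-th formula defines, at argument n, the value 0
    (respectively 1) are inseparable by a boolean function.  Code n by the n-th
    member [s n] of a pairwise coprime sequence, and let [a], [b] enumerate the
    codes of A and B.  For every standard e, the product d of the [a k] with
    k < e is divisible by all [a k] and by no [b k], k < e.  As [CT_Q]
    represents [a] and [b] by formulas, this property of e overspills to a
    nonstandard e, and a decider for the divisors of the resulting d would
    separate A and B. *)

From Stdlib Require Import List Arith Lia Cantor.
Require Import Defs.
Import ListNotations.

(** * Tarski semantics *)

Lemma eval_ext (M : interp) (rho rho' : nat -> M) t :
  (forall n, rho n = rho' n) -> eval M rho t = eval M rho' t.
Proof. intros H; induction t; cbn; congruence. Qed.

Lemma scons_ext (X : Type) (x : X) (xi xi' : nat -> X) :
  (forall n, xi n = xi' n) -> forall n, scons x xi n = scons x xi' n.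
Proof. intros H [|n]; cbn; auto. Qed.

Lemma ex_iff (X : Type) (p q : X -> Prop) :
  (forall x, p x <-> q x) -> (exists x, p x) <-> (exists x, q x).
Proof. firstorder. Qed.

Lemma all_iff (X : Type) (p q : X -> Prop) :
  (forall x, p x <-> q x) -> (forall x, p x) <-> (forall x, q x).
Proof. firstorder. Qed.

(** Assignments are compared pointwise, as functional extensionality is not assumed. *)
Lemma sat_ext (M : interp) phi : forall rho rho' : nat -> M,
  (forall n, rho n = rho' n) -> sat M rho phi <-> sat M rho' phi.
Proof.
  induction phi; cbn; intros rho rho' H.
  - tauto.
  - rewrite !(eval_ext M rho rho') by exact H. tauto.
  - specialize (IHphi1 _ _ H); specialize (IHphi2 _ _ H); tauto.
  - specialize (IHphi1 _ _ H); specialize (IHphi2 _ _ H); tauto.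
  - specialize (IHphi1 _ _ H); specialize (IHphi2 _ _ H); tauto.
  - apply all_iff; intros x. apply IHphi, scons_ext, H.
  - apply ex_iff; intros x. apply IHphi, scons_ext, H.
Qed.

Lemma eval_subst (M : interp) (rho : nat -> M) sigma t :
  eval M rho (subst_term sigma t) = eval M (fun n => eval M rho (sigma n)) t.
Proof. induction t; cbn; congruence. Qed.

Lemma eval_up (M : interp) (rho : nat -> M) sigma x n :
  eval M (scons x rho) (up sigma n)
  = scons x (fun n => eval M rho (sigma n)) n.
Proof.
  destruct n as [|n]; cbn; trivial.
  unfold shift_term. rewrite eval_subst. apply eval_ext. reflexivity.
Qed.

Lemma sat_subst (M : interp) phi : forall (rho : nat -> M) sigma,
  sat M rho (subst sigma phi) <-> sat M (fun n => eval M rho (sigma n)) phi.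
Proof.
  induction phi; cbn; intros rho sigma.
  - tauto.
  - rewrite !eval_subst. tauto.
  - rewrite IHphi1, IHphi2; tauto.
  - rewrite IHphi1, IHphi2; tauto.
  - rewrite IHphi1, IHphi2; tauto.
  - apply all_iff; intros x. rewrite IHphi. apply sat_ext, eval_up.
  - apply ex_iff; intros x. rewrite IHphi. apply sat_ext, eval_up.
Qed.

Lemma sat_shift (M : interp) (rho : nat -> M) x phi :
  sat M (scons x rho) (shift phi) <-> sat M rho phi.
Proof. unfold shift. rewrite sat_subst. apply sat_ext. reflexivity. Qed.

Lemma sat_inst (M : interp) (rho : nat -> M) t phi :
  sat M rho (inst t phi) <-> sat M (scons (eval M rho t) rho) phi.
Proof.
  unfold inst. rewrite sat_subst. apply sat_ext. intros [|n]; reflexivity.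
Qed.

Lemma eval_numeral (M : interp) (rho : nat -> M) n :
  eval M rho (numeral n) = i_num M n.
Proof. induction n; cbn; congruence. Qed.

Theorem soundness Gamma phi : prv Gamma phi ->
  forall (M : interp) (rho : nat -> M),
    (forall psi, In psi Gamma -> sat M rho psi) -> sat M rho phi.
Proof.
  intros H M.
  assert (Hcons : forall (rho : nat -> M) psi Gamma', sat M rho psi ->
    (forall theta, In theta Gamma' -> sat M rho theta) ->
    forall theta, In theta (psi :: Gamma') -> sat M rho theta).
  { intros rho psi Gamma' H1 H2 theta [<-|H3]; auto. }
  assert (Hshift : forall (rho : nat -> M) x Gamma',
    (forall theta, In theta Gamma' -> sat M rho theta) ->
    forall theta, In theta (map shift Gamma') -> sat M (scons x rho) theta).
  { intros rho x Gamma' H1 theta (psi & <- & H2)%in_map_iff.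
    apply sat_shift; auto. }
  induction H; intros rho HG; cbn in *.
  - auto.
  - destruct (IHprv rho HG).
  - intros Hphi. apply IHprv. now apply Hcons.
  - apply (IHprv1 rho HG), (IHprv2 rho HG).
  - auto.
  - apply (IHprv rho HG).
  - apply (IHprv rho HG).
  - auto.
  - auto.
  - destruct (IHprv1 rho HG); [apply IHprv2 | apply IHprv3];
      now apply Hcons.
  - intros x. apply IHprv. now apply Hshift.
  - apply sat_inst, (IHprv rho HG).
  - exists (eval M rho t). apply sat_inst, (IHprv rho HG).
  - destruct (IHprv1 rho HG) as [x Hx].
    apply (sat_shift M rho x). apply IHprv2.
    apply Hcons; [trivial | now apply Hshift].
Qed.

(** * Enumeration of formulas and derivations *)

(* Untyped syntax trees, read as terms, formulas or derivations alike. *)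
Inductive tree : Type :=
| Leaf : tree
| Node : nat -> tree -> tree -> tree -> tree.

(** Code 0 is [Leaf]; a positive code unpairs into a label and three subcodes. These are smaller,
    but not structurally so, hence the fuel. *)
Fixpoint decode_tree (fuel k : nat) : tree :=
  match fuel, k with
  | S fuel, S k =>
      let (n, k1) := Cantor.of_nat k in
      let (i, k2) := Cantor.of_nat k1 in
      let (j, l) := Cantor.of_nat k2 in
      Node n (decode_tree fuel i) (decode_tree fuel j) (decode_tree fuel l)
  | _, _ => Leaf
  end.

Definition tree_of (k : nat) : tree := decode_tree k k.

(** All fuel from k on is allowed because a subtree is decoded with the fuel its parent leaves, not
    with its own code. *)
Lemma decode_tree_surj t :
  exists k, forall fuel, k <= fuel -> decode_tree fuel k = t.
Proof.
  induction t as [|n t1 [k1 H1] t2 [k2 H2] t3 [k3 H3]].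
  - exists 0. intros [|fuel]; reflexivity.
  - pose (c2 := Cantor.to_nat (k2, k3)). pose (c1 := Cantor.to_nat (k1, c2)).
    exists (S (Cantor.to_nat (n, c1))). intros [|fuel] Hf; [lia|].
    pose proof (Cantor.to_nat_non_decreasing n c1).
    pose proof (Cantor.to_nat_non_decreasing k1 c2).
    pose proof (Cantor.to_nat_non_decreasing k2 k3).
    cbn [decode_tree]. rewrite Cantor.cancel_of_to. unfold c1 at 1.
    rewrite Cantor.cancel_of_to. unfold c2 at 1.
    rewrite Cantor.cancel_of_to.
    rewrite H1, H2, H3 by lia. reflexivity.
Qed.

Lemma tree_of_surj t : exists k, tree_of k = t.
Proof. destruct (decode_tree_surj t) as [k H]. exists k. now apply H. Qed.

Definition label (t : tree) : nat :=
  match t with Leaf => 0 | Node n _ _ _ => n end.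

Fixpoint tree_term (t : tree) : term :=
  match t with
  | Leaf => Zero
  | Node 0 a _ _ => Succ (tree_term a)
  | Node 1 a b _ => Add (tree_term a) (tree_term b)
  | Node 2 a b _ => Mul (tree_term a) (tree_term b)
  | Node (S (S (S n))) _ _ _ => Var n
  end.

Lemma tree_term_surj s : exists t, tree_term t = s.
Proof.
  induction s as [n| |s [a Ha]|s1 [a Ha] s2 [b Hb]|s1 [a Ha] s2 [b Hb]]; subst.
  - now exists (Node (S (S (S n))) Leaf Leaf Leaf).
  - now exists Leaf.
  - now exists (Node 0 a Leaf Leaf).
  - now exists (Node 1 a b Leaf).
  - now exists (Node 2 a b Leaf).
Qed.

Fixpoint tree_form (t : tree) : form :=
  match t with
  | Node 0 a b _ => Eq (tree_term a) (tree_term b)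
  | Node 1 a b _ => And (tree_form a) (tree_form b)
  | Node 2 a b _ => Or (tree_form a) (tree_form b)
  | Node 3 a b _ => Imp (tree_form a) (tree_form b)
  | Node 4 a _ _ => All (tree_form a)
  | Node 5 a _ _ => Ex (tree_form a)
  | _ => Fal
  end.

Lemma tree_form_surj phi : exists t, tree_form t = phi.
Proof.
  induction phi as [|r s|phi [a Ha] psi [b Hb]|phi [a Ha] psi [b Hb]
    |phi [a Ha] psi [b Hb]|phi [a Ha]|phi [a Ha]]; subst.
  - now exists Leaf.
  - destruct (tree_term_surj r) as [a <-], (tree_term_surj s) as [b <-].
    now exists (Node 0 a b Leaf).
  - now exists (Node 1 a b Leaf).
  - now exists (Node 2 a b Leaf).
  - now exists (Node 3 a b Leaf).
  - now exists (Node 4 a Leaf Leaf).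
  - now exists (Node 5 a Leaf Leaf).
Qed.

Definition form_of (n : nat) : form := tree_form (tree_of n).

Lemma form_of_surj phi : exists n, form_of n = phi.
Proof.
  destruct (tree_form_surj phi) as [t <-], (tree_of_surj t) as [n <-].
  now exists n.
Qed.

Definition term_eq_dec (s t : term) : {s = t} + {s <> t}.
Proof. repeat decide equality. Defined.

Definition form_eq_dec (phi psi : form) : {phi = psi} + {phi <> psi}.
Proof. decide equality; apply term_eq_dec. Defined.

(* Infers the conclusion of the derivation [t]; subtrees stand for
   subderivations or for the formulas and terms that a rule does not determine.
   The label of the first subtree is the position of a hypothesis. *)
Fixpoint infer (t : tree) (Gamma : list form) : option form :=
  match t with
  | Leaf => None
  | Node 0 a _ _ => nth_error Gamma (label a)
  | Node 1 a b _ =>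
      match infer a Gamma with
      | Some Fal => Some (tree_form b)
      | _ => None
      end
  | Node 2 a b _ =>
      match infer a (tree_form b :: Gamma) with
      | Some psi => Some (Imp (tree_form b) psi)
      | None => None
      end
  | Node 3 a b _ =>
      match infer a Gamma, infer b Gamma with
      | Some (Imp phi psi), Some phi' =>
          if form_eq_dec phi phi' then Some psi else None
      | _, _ => None
      end
  | Node 4 a b _ =>
      match infer a Gamma, infer b Gamma with
      | Some phi, Some psi => Some (And phi psi)
      | _, _ => None
      end
  | Node 5 a _ _ =>
      match infer a Gamma with Some (And phi _) => Some phi | _ => None end
  | Node 6 a _ _ =>
      match infer a Gamma with Some (And _ psi) => Some psi | _ => None end
  | Node 7 a b _ =>
      match infer a Gamma with
      | Some phi => Some (Or phi (tree_form b))
      | None => None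
      end
  | Node 8 a b _ =>
      match infer a Gamma with
      | Some psi => Some (Or (tree_form b) psi)
      | None => None
      end
  | Node 9 a b c =>
      match infer a Gamma with
      | Some (Or phi psi) =>
          match infer b (phi :: Gamma), infer c (psi :: Gamma) with
          | Some theta, Some theta' =>
              if form_eq_dec theta theta' then Some theta else None
          | _, _ => None
          end
      | _ => None
      end
  | Node 10 a _ _ =>
      match infer a (map shift Gamma) with
      | Some phi => Some (All phi)
      | None => None
      end
  | Node 11 a b _ =>
      match infer a Gamma with
      | Some (All phi) => Some (inst (tree_term b) phi)
      | _ => None
      end
  | Node 12 a b c =>
      match infer a Gamma with
      | Some phi =>
          if form_eq_dec phi (inst (tree_term b) (tree_form c))
          then Some (Ex (tree_form c)) else None
      | None => None
      end
  | Node _ a b c =>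
      match infer a Gamma with
      | Some (Ex phi) =>
          match infer b (phi :: map shift Gamma) with
          | Some psi =>
              if form_eq_dec psi (shift (tree_form c))
              then Some (tree_form c) else None
          | None => None
          end
      | _ => None
      end
  end.

Lemma infer_sound t : forall Gamma phi,
  infer t Gamma = Some phi -> prv Gamma phi.
Proof.
  induction t as [|n a IHa b IHb c IHc]; intros Gamma phi H; [discriminate|].
  (* Labels 0 to 12 become separate goals; the last goal covers every label from 13 on, all read as
     [ExE]. *)
  do 13 try destruct n as [|n]; cbn in H;
    [eauto using Ctx, nth_error_In | ..];
    repeat match type of H with
    | context [match infer ?t ?G with _ => _ end] =>
        let E := fresh in destruct (infer t G) eqn:E; try discriminate H
    | context [if form_eq_dec ?p ?q then _ else _] =>
        destruct (form_eq_dec p q); try discriminate H; subst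
    | context [match ?f with Fal => _ | _ => _ end] =>
        is_var f; destruct f; try discriminate H
    end; injection H as <-; eauto using prv.
Qed.

Lemma infer_complete Gamma phi :
  prv Gamma phi -> exists t, infer t Gamma = Some phi.
Proof.
  induction 1 as [Gamma phi H|Gamma phi _ [a Ha]|Gamma phi psi _ [a Ha]
    |Gamma phi psi _ [a Ha] _ [b Hb]|Gamma phi psi _ [a Ha] _ [b Hb]
    |Gamma phi psi _ [a Ha]|Gamma phi psi _ [a Ha]|Gamma phi psi _ [a Ha]
    |Gamma phi psi _ [a Ha]|Gamma phi psi theta _ [a Ha] _ [b Hb] _ [c Hc]
    |Gamma phi _ [a Ha]|Gamma phi t _ [a Ha]|Gamma phi t _ [a Ha]
    |Gamma phi psi _ [a Ha] _ [b Hb]].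
  - destruct (In_nth_error _ _ H) as [i Hi].
    now exists (Node 0 (Node i Leaf Leaf Leaf) Leaf Leaf).
  - destruct (tree_form_surj phi) as [b <-].
    exists (Node 1 a b Leaf). cbn. now rewrite Ha.
  - destruct (tree_form_surj phi) as [b <-].
    exists (Node 2 a b Leaf). cbn. now rewrite Ha.
  - exists (Node 3 a b Leaf). cbn. rewrite Ha, Hb.
    destruct form_eq_dec; congruence.
  - exists (Node 4 a b Leaf). cbn. now rewrite Ha, Hb.
  - exists (Node 5 a Leaf Leaf). cbn. now rewrite Ha.
  - exists (Node 6 a Leaf Leaf). cbn. now rewrite Ha.
  - destruct (tree_form_surj psi) as [b <-].
    exists (Node 7 a b Leaf). cbn. now rewrite Ha.
  - destruct (tree_form_surj phi) as [b <-].
    exists (Node 8 a b Leaf). cbn. now rewrite Ha.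
  - exists (Node 9 a b c). cbn. rewrite Ha, Hb, Hc.
    destruct form_eq_dec; congruence.
  - exists (Node 10 a Leaf Leaf). cbn. now rewrite Ha.
  - destruct (tree_term_surj t) as [b <-].
    exists (Node 11 a b Leaf). cbn. now rewrite Ha.
  - destruct (tree_term_surj t) as [b <-], (tree_form_surj phi) as [c <-].
    exists (Node 12 a b c). cbn. rewrite Ha.
    destruct form_eq_dec; congruence.
  - destruct (tree_form_surj psi) as [c <-].
    exists (Node 13 a b c). cbn. rewrite Ha, Hb.
    destruct form_eq_dec; congruence.
Qed.

(** * A pairwise coprime sequence *)

(** These are the partial products of Sylvester's sequence 2, 3, 7, 43, ..., in which each member is
    the product of its predecessors plus 1. *)
Fixpoint sylvester_prod (n : nat) : nat :=
  match n with
  | 0 => 1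
  | S n => sylvester_prod n * S (sylvester_prod n)
  end.

Definition sylvester (n : nat) : nat := S (sylvester_prod n).

Lemma sylvester_prod_pos n : 0 < sylvester_prod n.
Proof. induction n; cbn; lia. Qed.

Lemma sylvester_divide_prod m n :
  m < n -> Nat.divide (sylvester m) (sylvester_prod n).
Proof.
  induction 1 as [|n _ IH]; cbn [sylvester_prod].
  - apply Nat.divide_factor_r.
  - now apply Nat.divide_mul_l.
Qed.

(** A common divisor of two members divides the product of all predecessors of the larger one, and
    also that product plus 1. *)
Lemma sylvester_coprime m n :
  m <> n -> Nat.gcd (sylvester m) (sylvester n) = 1.
Proof.
  assert (Hlt : forall m n, m < n -> Nat.gcd (sylvester m) (sylvester n) = 1).
  { clear m n. intros m n Hmn.
    apply Nat.divide_1_r.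
    apply Nat.divide_add_cancel_r with (sylvester_prod n).
    - apply Nat.divide_trans with (sylvester m);
        [apply Nat.gcd_divide_l | now apply sylvester_divide_prod].
    - rewrite Nat.add_1_r. apply Nat.gcd_divide_r. }
  intros Hmn. destruct (Nat.lt_total m n) as [H|[H|H]].
  - now apply Hlt.
  - contradiction.
  - rewrite Nat.gcd_comm. now apply Hlt.
Qed.

Fixpoint prod_below (a : nat -> nat) (n : nat) : nat :=
  match n with
  | 0 => 1
  | S n => prod_below a n * a n
  end.

Lemma divide_prod_below a k n : k < n -> Nat.divide (a k) (prod_below a n).
Proof.
  induction 1 as [|n _ IH]; cbn.
  - apply Nat.divide_factor_r.
  - now apply Nat.divide_mul_l.
Qed.

(** Gauss's lemma strips the factors off one by one until q divides the empty product. *)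
Lemma coprime_divide_prod_below a q n :
  (forall k, Nat.gcd q (a k) = 1) -> Nat.divide q (prod_below a n) -> q = 1.
Proof.
  intros Ha. induction n as [|n IH]; cbn.
  - apply Nat.divide_1_r.
  - rewrite Nat.mul_comm. intros H. apply IH.
    now apply Nat.gauss with (a n).
Qed.

Lemma prod_below_pos a n : (forall k, 0 < a k) -> 0 < prod_below a n.
Proof. intros Ha. induction n as [|n IH]; cbn; [|specialize (Ha n)]; nia. Qed.

(** * Inseparable sets of formula codes *)

(** This is the clause of [CT_Q] at argument n for a function with value v there. *)
Definition defines_value (n v : nat) (phi : form) : form :=
  All (Iff (inst (numeral n) phi) (Eq (numeral v) (Var 0))).

(* Stage [k] is a pair of a formula code [n] and a candidate derivation [p]. *)
Definition stage (v default k : nat) : nat :=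
  let (n, p) := Cantor.of_nat k in
  match infer (tree_of p) Q with
  | Some phi =>
      if form_eq_dec phi (defines_value n v (form_of n))
      then sylvester n else default
  | None => default
  end.

Lemma stage_cases v default k :
  stage v default k = default \/
  exists n, stage v default k = sylvester n /\
    prv Q (defines_value n v (form_of n)).
Proof.
  unfold stage. destruct (Cantor.of_nat k) as [n p].
  destruct (infer (tree_of p) Q) as [phi|] eqn:E; auto.
  destruct form_eq_dec as [->|]; auto.
  right. exists n. eauto using infer_sound.
Qed.

Lemma stage_complete v default n :
  prv Q (defines_value n v (form_of n)) ->
  exists k, stage v default k = sylvester n.
Proof.
  intros (t & Ht)%infer_complete. destruct (tree_of_surj t) as [p <-].
  exists (Cantor.to_nat (n, p)). unfold stage.
  rewrite Cantor.cancel_of_to, Ht. destruct form_eq_dec; congruence.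
Qed.

(** Positivity is what [divides_num_iff] asks of a dividend, and it keeps the default 0 from
    dividing the product. *)
Lemma prod_stage_pos v n : 0 < prod_below (stage v 1) n.
Proof.
  apply prod_below_pos. intros k.
  destruct (stage_cases v 1 k) as [->|(i & -> & _)]; unfold sylvester; lia.
Qed.

(** * Models of Heyting arithmetic *)

Definition divides (M : interp) (x y : M) : Prop :=
  exists z, i_mul M x z = y.

Definition less (M : interp) (x y : M) : Prop :=
  exists z, i_succ M (i_add M x z) = y.

Lemma num_divides_iff M n d : num_divides M n d <-> divides M (i_num M n) d.
Proof.
  unfold num_divides, divides; cbn. apply ex_iff; intros z.
  unfold shift_term. rewrite eval_subst, eval_numeral. tauto.
Qed.

Section Model.

Variable M : interp.
Hypothesis HM : HA_model M.

Lemma model_axiom phi (rho : nat -> M) :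
  In phi (eq_axioms ++ arith_axioms) -> sat M rho phi.
Proof. intros H. apply HM. now left. Qed.

Lemma model_succ_neq_zero (x : M) : i_succ M x <> i_zero M.
Proof.
  refine (model_axiom (All (Imp (Eq (Succ (Var 0)) Zero) Fal))
    (fun _ => i_zero M) _ x). cbn; tauto.
Qed.

Lemma model_succ_inj (x y : M) : i_succ M x = i_succ M y -> x = y.
Proof.
  refine (model_axiom (All (All (Imp (Eq (Succ (Var 1)) (Succ (Var 0)))
    (Eq (Var 1) (Var 0))))) (fun _ => i_zero M) _ x y). cbn; tauto.
Qed.

Lemma model_add_zero (x : M) : i_add M (i_zero M) x = x.
Proof.
  refine (model_axiom (All (Eq (Add Zero (Var 0)) (Var 0)))
    (fun _ => i_zero M) _ x). cbn; tauto.
Qed.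

Lemma model_add_succ (x y : M) :
  i_add M (i_succ M x) y = i_succ M (i_add M x y).
Proof.
  refine (model_axiom (All (All (Eq (Add (Succ (Var 1)) (Var 0))
    (Succ (Add (Var 1) (Var 0)))))) (fun _ => i_zero M) _ x y). cbn; tauto.
Qed.

Lemma model_mul_zero (x : M) : i_mul M (i_zero M) x = i_zero M.
Proof.
  refine (model_axiom (All (Eq (Mul Zero (Var 0)) Zero))
    (fun _ => i_zero M) _ x). cbn; tauto.
Qed.

Lemma model_mul_succ (x y : M) :
  i_mul M (i_succ M x) y = i_add M y (i_mul M x y).
Proof.
  refine (model_axiom (All (All (Eq (Mul (Succ (Var 1)) (Var 0))
    (Add (Var 0) (Mul (Var 1) (Var 0)))))) (fun _ => i_zero M) _ x y).
  cbn; tauto.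
Qed.

Lemma model_induction phi (rho : nat -> M) :
  sat M (scons (i_zero M) rho) phi ->
  (forall x, sat M (scons x rho) phi ->
     sat M (scons (i_succ M x) rho) phi) ->
  forall x, sat M (scons x rho) phi.
Proof.
  intros H0 HS.
  apply (HM (ax_induction phi) (or_intror (ex_intro _ phi eq_refl)) rho).
  - now apply sat_inst.
  - intros x Hx. apply sat_subst.
    apply (sat_ext M phi (scons (i_succ M x) rho)); [|now apply HS].
    intros [|n]; reflexivity.
Qed.

(** This is the one axiom of [Q] not listed in [HA]; induction supplies it, so M satisfies [Q]. *)
Lemma model_cases (x : M) : x = i_zero M \/ exists y, x = i_succ M y.
Proof.
  apply (model_induction (Or (Eq (Var 0) Zero) (Ex (Eq (Var 1) (Succ (Var 0)))))
    (fun _ => i_zero M)); cbn; eauto.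
Qed.

Lemma model_Q (rho : nat -> M) phi : In phi Q -> sat M rho phi.
Proof.
  unfold Q. rewrite app_assoc. intros [H|[<-|[]]]%in_app_or.
  - now apply model_axiom.
  - intros x. apply model_cases.
Qed.

Lemma num_inj m n : i_num M m = i_num M n -> m = n.
Proof.
  revert n. induction m as [|m IH]; intros [|n] H; cbn in H; trivial.
  - symmetry in H. now apply model_succ_neq_zero in H.
  - now apply model_succ_neq_zero in H.
  - f_equal. now apply IH, model_succ_inj.
Qed.

Lemma num_add m n : i_add M (i_num M m) (i_num M n) = i_num M (m + n).
Proof.
  induction m as [|m IH]; cbn.
  - apply model_add_zero.
  - rewrite model_add_succ. congruence.
Qed.

Lemma num_mul m n : i_mul M (i_num M m) (i_num M n) = i_num M (m * n).
Proof.
  induction m as [|m IH]; cbn.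
  - apply model_mul_zero.
  - rewrite model_mul_succ, IH. apply num_add.
Qed.

(** Successors are stripped from x and n in parallel; x reaches zero no later than n, since zero is
    not a successor. *)
Lemma add_num_inv (x z : M) n :
  i_add M x z = i_num M n -> exists m, m <= n /\ x = i_num M m.
Proof.
  revert x. induction n as [|n IH]; intros x H;
    destruct (model_cases x) as [->|[y ->]];
    try (exists 0; split; [lia | reflexivity]);
    rewrite model_add_succ in H; cbn in H.
  - now apply model_succ_neq_zero in H.
  - destruct (IH y) as (m & Hm & ->); [now apply model_succ_inj|].
    exists (S m). split; [lia | reflexivity].
Qed.

Lemma less_num_inv (x : M) n :
  less M x (i_num M n) -> exists m, m < n /\ x = i_num M m.
Proof.
  intros [z H]. destruct n as [|n]; cbn in H.
  - now apply model_succ_neq_zero in H.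
  - apply model_succ_inj, add_num_inv in H as (m & Hm & ->).
    exists m. split; [lia | reflexivity].
Qed.

(** Case analysis strips up to n + 1 successors from e: either zero is reached, or the remainder
    witnesses the inequality. *)
Lemma std_or_num_less n (e : M) : std M e \/ less M (i_num M n) e.
Proof.
  revert e. induction n as [|n IH]; intros e;
    destruct (model_cases e) as [->|[y ->]]; try (left; now exists 0).
  - right. exists y. cbn. now rewrite model_add_zero.
  - destruct (IH y) as [[m <-]|[z <-]].
    + left. now exists (S m).
    + right. exists z. cbn. now rewrite model_add_succ.
Qed.

(** The quotient is a priori any element of M. For positive m it is a summand of the standard
    dividend, hence standard; m = 0 would force n = 0. *)
Lemma divides_num_iff m n :
  0 < n -> divides M (i_num M m) (i_num M n) <-> Nat.divide m n.
Proof.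
  intros Hn. split.
  - intros [x H]. destruct m as [|m].
    + cbn in H. rewrite model_mul_zero in H. apply (num_inj 0) in H. lia.
    + pose proof H as H'. cbn in H'. rewrite model_mul_succ in H'.
      apply add_num_inv in H' as (c & _ & ->).
      rewrite num_mul in H. apply num_inj in H. exists c. lia.
  - intros [c ->]. exists (i_num M c). rewrite num_mul. f_equal. lia.
Qed.

(** If no nonstandard element satisfied phi, stability would make phi define [std]. As [std] is
    closed under successor, induction on phi would then make every element standard. *)
Lemma overspill phi (rho : nat -> M) :
  stable (std M) -> nonstandard M ->
  (forall n, sat M (scons (i_num M n) rho) phi) ->
  ~ ~ exists e, ~ std M e /\ sat M (scons e rho) phi.
Proof.
  intros Hstable [e He] Hphi Hno.
  assert (Hstd : forall x, sat M (scons x rho) phi -> std M x).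
  { intros x Hx. apply Hstable. intros Hx'. apply Hno. now exists x. }
  apply He, Hstd. apply model_induction.
  - apply (Hphi 0).
  - intros x Hx. destruct (Hstd x Hx) as [n <-]. apply (Hphi (S n)).
Qed.

Lemma model_defines_value n v phi (rho : nat -> M) y :
  prv Q (defines_value n v phi) ->
  sat M (scons (i_num M n) (scons y rho)) phi <-> y = i_num M v.
Proof.
  intros H. pose proof (soundness _ _ H M rho (model_Q rho) y) as Hy.
  cbn in Hy. rewrite sat_inst, !eval_numeral in Hy.
  split; [intros H1; symmetry | intros ->]; now apply Hy.
Qed.

(* The formula says of [Var 0] = e that
   exists d, forall k < e, (forall y, alpha(k,y) -> y | d) /\
                           (forall y, beta(k,y) -> ~ y | d). *)
Definition separator_form (alpha beta : form) : form :=
  let sigma := scons (Var 1) (scons (Var 0) Var) in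
  let dvd := Ex (Eq (Mul (Var 1) (Var 0)) (Var 3)) in
  Ex (All (Imp (Ex (Eq (Succ (Add (Var 1) (Var 0))) (Var 3)))
    (And (All (Imp (subst sigma alpha) dvd))
         (All (Imp (subst sigma beta) (Neg dvd)))))).

Definition represents (phi : form) (f : nat -> nat) : Prop :=
  forall n, prv Q (defines_value n (f n) phi).

(** A representing formula has its argument at [Var 0] and its value at [Var 1], but in
    [separator_form] the value y is bound innermost; the substitution swaps the two. *)
Lemma sat_represents phi f (rho : nat -> M) n y :
  represents phi f ->
  sat M (scons y (scons (i_num M n) rho))
    (subst (scons (Var 1) (scons (Var 0) Var)) phi) <-> y = i_num M (f n).
Proof.
  intros H. rewrite <- (model_defines_value n (f n) phi
    (scons y (scons (i_num M n) rho)) y (H n)).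
  rewrite sat_subst. apply sat_ext. intros [|[|m]]; reflexivity.
Qed.

(** Elements of M below a numeral are numerals, and there divisibility agrees with [Nat.divide], so
    a separating number also separates in M. *)
Lemma sat_separator_form_num alpha beta a b n d (rho : nat -> M) :
  represents alpha a -> represents beta b -> 0 < d ->
  (forall k, k < n -> Nat.divide (a k) d /\ ~ Nat.divide (b k) d) ->
  sat M (scons (i_num M n) rho) (separator_form alpha beta).
Proof.
  intros Ha Hb Hd Hsep. exists (i_num M d). intros k Hk.
  apply (less_num_inv k n) in Hk as (m & Hm & ->).
  destruct (Hsep m Hm) as [H1 H2]. split; intros y Hy.
  - apply (sat_represents _ _ _ _ _ Ha) in Hy as ->.
    now apply divides_num_iff.
  - apply (sat_represents _ _ _ _ _ Hb) in Hy as ->.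
    intros Hdvd. apply H2. now apply divides_num_iff.
Qed.

(** Every numeral lies below a nonstandard e, so the bound k < e admits all natural numbers k. *)
Lemma sat_separator_form_nonstd alpha beta a b e (rho : nat -> M) :
  represents alpha a -> represents beta b -> ~ std M e ->
  sat M (scons e rho) (separator_form alpha beta) ->
  exists d, forall k,
    divides M (i_num M (a k)) d /\ ~ divides M (i_num M (b k)) d.
Proof.
  intros Ha Hb He [d Hd]. exists d. intros k.
  assert (Hk : less M (i_num M k) e)
    by (destruct (std_or_num_less k e); tauto).
  destruct (Hd _ Hk) as [H1 H2]. split.
  - apply H1. now apply (sat_represents _ _ _ _ _ Ha).
  - apply H2. now apply (sat_represents _ _ _ _ _ Hb).
Qed.

(** Here M witnesses the consistency of [Q]: both numerals are the unique value in M, where numerals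
    are injective. Thus A and B are disjoint. *)
Lemma defines_value_unique n v w phi :
  prv Q (defines_value n v phi) -> prv Q (defines_value n w phi) -> v = w.
Proof.
  intros Hv Hw. apply num_inj.
  apply (model_defines_value n w phi (fun _ => i_zero M) _ Hw).
  now apply (model_defines_value n v phi).
Qed.

(* The defaults 1 and 0 are harmless: 1 divides everything, and 0 divides no
   positive number. *)
Lemma prod_stage_separates n k :
  k < n ->
  Nat.divide (stage 0 1 k) (prod_below (stage 0 1) n) /\
  ~ Nat.divide (stage 1 0 k) (prod_below (stage 0 1) n).
Proof.
  intros Hk. split; [now apply divide_prod_below|]. intros H.
  destruct (stage_cases 1 0 k) as [E|(m & E & Hm)]; rewrite E in H.
  - apply Nat.divide_0_l in H.
    pose proof (prod_stage_pos 0 n). lia.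
  - apply coprime_divide_prod_below in H.
    + pose proof (sylvester_prod_pos m). unfold sylvester in H. lia.
    + intros j. destruct (stage_cases 0 1 j) as [->|(i & -> & Hi)].
      * apply Nat.divide_1_r, Nat.gcd_divide_r.
      (* Equal codes would define both 1 and 0 at the same argument. *)
      * apply sylvester_coprime. intros <-.
        discriminate (defines_value_unique _ _ _ _ Hm Hi).
Qed.

End Model.

(** * Diagonalisation against deciders, and the conclusion *)

Lemma stages_inseparable (p : nat -> Prop) :
  CT_Q ->
  (forall k, p (stage 0 1 k)) -> (forall k, ~ p (stage 1 0 k)) -> ~ Dec p.
Proof.
  intros HCT H0 H1 [f Hf].
  (* The values contradict f: an accepted code gets 1, the value of B, whose stages p excludes; a
     rejected one gets 0, the value of A. *)
  destruct (HCT (fun n => if f (sylvester n) then 1 else 0))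
    as (phi & _ & _ & Hphi).
  (* The diagonal step: n is a code of phi itself, so [Hphi] places n in A or B against the answer
     of f. *)
  destruct (form_of_surj phi) as [n <-]. specialize (Hphi n).
  destruct (f (sylvester n)) eqn:E.
  - destruct (stage_complete 1 0 n Hphi) as [k Hk].
    apply (H1 k). rewrite Hk. now apply Hf.
  - destruct (stage_complete 0 1 n Hphi) as [k Hk].
    specialize (H0 k). rewrite Hk in H0. apply Hf in H0. congruence.
Qed.

Theorem theorem7p10 :
  CT_Q ->
  forall M : interp,
    HA_model M ->
    stable (std M) ->
    nonstandard M ->
    ~ ~ exists d : M, ~ Dec (fun n : nat => num_divides M n d).
Proof.
  intros HCT M HM Hstable Hnonstd Hno.
  destruct (HCT (stage 0 1)) as (alpha & _ & _ & Halpha).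
  destruct (HCT (stage 1 0)) as (beta & _ & _ & Hbeta).
  apply (overspill M HM (separator_form alpha beta) (fun _ => i_zero M)
    Hstable Hnonstd).
  - intros n.
    apply (sat_separator_form_num M HM alpha beta (stage 0 1) (stage 1 0) n
      (prod_below (stage 0 1) n)); trivial.
    + apply prod_stage_pos.
    + intros k. now apply (prod_stage_separates M HM).
  - intros (e & He & Hsat).
    destruct (sat_separator_form_nonstd M HM alpha beta (stage 0 1) (stage 1 0)
      e _ Halpha Hbeta He Hsat) as [d Hd].
    (* Being a divisor of d holds along the whole enumeration of A and fails along that of B. *)
    apply Hno. exists d. apply stages_inseparable; trivial;
      intros k; rewrite num_divides_iff; apply Hd.
Qed.
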